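(* Let $q$ be a prime power and $\ell_\infty$ a line of $\mathrm{PG}(2,q^3)$. The subgroup of $\mathrm{PGL}(3,q^3)$ fixing $\ell_\infty$ (as a set) is transitive on the set of order-$q$-subplanes of $\mathrm{PG}(2,q^3)$ that meet $\ell_\infty$ in exactly one point.
   Context: An order-$q$-subplane of $\mathrm{PG}(2,q^3)$ is a subplane of order $q$, equivalently an image of $\mathrm{PG}(2,q)$ under $\mathrm{PGL}(3,q^3)$. *)

(* Defs.v *)
From HB Require Import structures.
From mathcomp Require Import all_boot all_order all_algebra all_fingroup all_solvable.

Set Implicit Arguments.
Unset Strict Implicit.
Unset Printing Implicit Defensive.

Import GRing.Theory.
Local Open Scope ring_scope.

Definition prime_power (q : nat) : Prop :=
  exists p e : nat, [/\ prime p, (0 < e)%N & q = (p ^ e)%N].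

(* The incidence structure with points P, lines L and incidence I is a
   projective plane of order n. *)
Definition projective_plane_of_order (T U : finType) (I : T -> U -> bool)
    (P : {set T}) (L : {set U}) (n : nat) : bool :=
  [&& [forall x in P, forall y in P,
         (x != y) ==> (#|[set l in L | I x l && I y l]| == 1)],
      [forall l in L, forall m in L,
         (l != m) ==> (#|[set x in P | I x l && I x m]| == 1)],
      (* four points, no three of which are on a line *)
      [exists A : {set T}, [&& A \subset P, #|A| == 4 &
         [forall l in L, #|[set x in A | I x l]| <= 2]]]
    & [forall l in L, #|[set x in P | I x l]| == n.+1]]%N.

Section FiniteVspace.
Import VectorInternalTheory.
Variables (K : finFieldType) (vT : vectType K).
HB.instance Definition _ := [Countable of {vspace vT} by <:].
HB.instance Definition _ := [Finite of {vspace vT} by <:].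
End FiniteVspace.

Section PG2.
Variable K : finFieldType.

(* Points and lines of PG(2,K) are the subspaces of K^3 of dimension 1 and 2;
   incidence is inclusion. *)
Definition PGpoints : {set {vspace 'rV[K]_3}} := [set P | \dim P == 1%N].
Definition PGlines : {set {vspace 'rV[K]_3}} := [set l | \dim l == 2%N].

Definition points_on (l : {vspace 'rV[K]_3}) : {set {vspace 'rV[K]_3}} :=
  [set P in PGpoints | (P <= l)%VS].

(* A subplane is given by its point set B; its lines are the lines of PG(2,K)
   joining two distinct points of B. *)
Definition subplane_of_order (n : nat) (B : {set {vspace 'rV[K]_3}}) : bool :=
  (B \subset PGpoints) &&
  projective_plane_of_order (fun P l => (P <= l)%VS) B
    [set l in PGlines | (1 < #|B :&: points_on l|)%N] n.

Definition GLimg (U : {vspace 'rV[K]_3}) (g : {'GL_3[K]}) : {vspace 'rV[K]_3} :=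
  (linfun (mulmxr (GLval g)) @: U)%VS.

Lemma GLimg1 U : GLimg U 1%g = U.
Proof.
rewrite -[RHS]lim1g; congr lfun_img.
by apply/lfunP=> v; rewrite lfunE /= id_lfunE mulmx1.
Qed.

Lemma GLimgM U : act_morph GLimg U.
Proof.
move=> g h; rewrite /GLimg -limg_comp; congr lfun_img.
by apply/lfunP=> v; rewrite comp_lfunE !lfunE /= mulmxA.
Qed.

Canonical GLact := TotalAction GLimg1 GLimgM.

Definition PGL3 : {group coset_of 'Z('GL_3[K])} := ('GL_3[K] / 'Z('GL_3[K]))%G.

(* The induced action of PGL(3,K) on subspaces; %% makes everything act trivially
   on a subspace moved by the centre, but there is none, see PGLactE. *)
Definition PGLact := (GLact %% 'Z('GL_3[K]))%act.

Lemma center_GL_scalar (z : {'GL_3[K]}) :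
  (z \in 'Z('GL_3[K]))%g -> exists2 a : K, a != 0 & GLval z = a%:M.
Proof.
case/centerP=> _ cz.
have tv (i j : 'I_3) : i != j -> delta_mx i j *m GLval z = GLval z *m delta_mx i j.
  move=> ij; have u : (1%:M + delta_mx i j : 'M[K]_3) \is a GRing.unit.
    apply/unitrP; exists (1%:M - delta_mx i j).
    have d0 : delta_mx i j *m delta_mx i j = 0 :> 'M[K]_3.
      by rewrite mul_delta_mx_0 // eq_sym.
    split; rewrite -mulmxE ?mulmxBl ?mulmxBr ?mulmxDl ?mulmxDr ?mulmx1 ?mul1mx d0.
      by rewrite addr0 addrK.
    by rewrite ?subr0 ?addr0 ?addrK ?subrK.
  pose g : {'GL_3[K]} := FinRing.unit _ u.
  have := congr1 (fun x : {'GL_3[K]} => GLval x : 'M[K]_3) (cz g (in_setT _)).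
  rewrite /= !mulmxE mulrDl mulrDr mul1r mulr1.
  by move/addrI.
have E (i j i' j' k : 'I_3) : (delta_mx i j *m GLval z) i' k = (i' == i)%:R * GLval z j k.
  rewrite mxE (bigD1 j) //= big1 ?addr0 ?mxE ?eqxx ?andbT // => l /negPf lj.
  by rewrite mxE lj andbF mul0r.
have E' (i j i' j' k : 'I_3) : (GLval z *m delta_mx i j) i' k = (k == j)%:R * GLval z i' i.
  rewrite mxE (bigD1 i) //= big1 ?addr0 ?mxE ?eqxx ?andbT 1?mulrC // => l /negPf lj.
  by rewrite mxE lj /= mulr0.
have [a za] : exists a : K, GLval z = a%:M.
  exists (GLval z 0 0); apply/matrixP=> i j; rewrite mxE.
  have [<-|ij] := eqVneq i j; last first.
    have ji : j != i by rewrite eq_sym.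
    have /matrixP/(_ j j) := tv _ _ ji.
    by rewrite E ?E' // eqxx mul1r (negPf ji) mul0r.
  have [->//|i0] := eqVneq i 0.
  have i0' : 0 != i by rewrite eq_sym.
  have /matrixP/(_ 0 i) := tv _ _ i0'.
  by rewrite E ?E' // !eqxx !mul1r.
exists a => //; apply/eqP=> a0.
by have := GL_det z; rewrite za a0 det_scalar expr0n eqxx.
Qed.

Lemma PGLactE U (g : {'GL_3[K]}) :
  PGLact U (coset 'Z('GL_3[K]) g) = GLimg U g.
Proof.
have gN : g \in 'N('Z('GL_3[K]))%g.
  by have /normal_norm/subsetP := center_normal 'GL_3[K]; apply; apply: in_setT.
apply: modactE => //.
apply/afixP=> z /setIP[_ /center_GL_scalar[a a0 za]].
rewrite /= /GLimg; have -> : linfun (mulmxr (GLval z)) = (a *: \1)%VF :> 'End('rV[K]_3).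
  by apply/lfunP=> v; rewrite lfunE /= za scale_lfunE id_lfunE mul_mx_scalar.
apply/vspaceP=> v; apply/memv_imgP/idP => [[u uU ->]|vU].
  by rewrite scale_lfunE id_lfunE memvZ.
by exists (a^-1 *: v); rewrite ?memvZ // scale_lfunE id_lfunE scalerA mulfV ?scale1r.
Qed.

End PG2.

(* Main.v *)
Require Import Defs.
From mathcomp Require Import all_boot all_order all_algebra all_fingroup all_solvable.
From mathcomp Require Import finfield ring zify.

Set Implicit Arguments.
Unset Strict Implicit.
Unset Printing Implicit Defensive.

(* Let F = {a | a^q = a} be the subfield of order q. In homogeneous coordinates,
   the meet of the joins xy and zw is (x * y) * (z * w) with * the cross product.
   Map four points of an order-q-subplane, no three collinear, to the standard
   frame. The set R of all a with (a,0,1) in the subplane is then closed under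
   multiplication (von Staudt) and has q elements, so its nonzero elements satisfy
   a^(q-1) = 1; thus R = F and the subplane is PG(2,F).
   Fix t outside F. It remains to map the line X + tY = 0 to any line u.y = 0
   meeting PG(2,F) only in s, by an element of GL(3,F). Over F, the map sending a
   pair of vectors (y1, y2) of F^3 to t (u.y1) - u.y2 has values in a space of
   dimension 3, so even after fixing one coordinate of y1 and of y2 its kernel is
   nontrivial; the matrix with rows y1, y2, s does the job. *)

Import GRing.Theory.
Local Open Scope ring_scope.


(** * Dot and cross products in K^3 *)

Definition o0 : 'I_3 := @Ordinal 3 0 isT.
Definition o1 : 'I_3 := @Ordinal 3 1 isT.
Definition o2 : 'I_3 := @Ordinal 3 2 isT.

Lemma ord3_ind (P : 'I_3 -> Prop) : P o0 -> P o1 -> P o2 -> forall i, P i.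
Proof.
move=> P0 P1 P2 [[|[|[|//]]] lti].
- by rewrite (_ : Ordinal lti = o0) //; apply: val_inj.
- by rewrite (_ : Ordinal lti = o1) //; apply: val_inj.
- by rewrite (_ : Ordinal lti = o2) //; apply: val_inj.
Qed.

Lemma sum_ord3 (V : nmodType) (f : 'I_3 -> V) : \sum_i f i = f o0 + f o1 + f o2.
Proof.
rewrite 3!big_ord_recr big_ord0 /= add0r.
by congr (f _ + f _ + f _); apply: val_inj.
Qed.

Section Coordinates.
Variable K : fieldType.
Implicit Types (x y z u v : 'rV[K]_3) (k : K).

Definition vec (a b c : K) : 'rV[K]_3 := \row_i nth 0 [:: a; b; c] i.

Definition dot x y : K :=
  x 0 o0 * y 0 o0 + x 0 o1 * y 0 o1 + x 0 o2 * y 0 o2.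

Definition cross x y : 'rV[K]_3 :=
  vec (x 0 o1 * y 0 o2 - x 0 o2 * y 0 o1)
      (x 0 o2 * y 0 o0 - x 0 o0 * y 0 o2)
      (x 0 o0 * y 0 o1 - x 0 o1 * y 0 o0).

Definition rows3 x y z : 'M[K]_3 := \matrix_(i, j) (nth 0 [:: x; y; z] i) 0 j.

Lemma vecP x y :
  x 0 o0 = y 0 o0 -> x 0 o1 = y 0 o1 -> x 0 o2 = y 0 o2 -> x = y.
Proof. by move=> e0 e1 e2; apply/rowP; elim/ord3_ind. Qed.

Lemma vecE x : x = vec (x 0 o0) (x 0 o1) (x 0 o2).
Proof. by apply: vecP; rewrite mxE. Qed.

Lemma vec_eq0 a b c : (vec a b c == 0) = [&& a == 0, b == 0 & c == 0].
Proof.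
apply/eqP/and3P => [/rowP e|[/eqP-> /eqP-> /eqP->]]; last first.
  by apply: vecP; rewrite !mxE.
by split; [have := e o0 | have := e o1 | have := e o2]; rewrite !mxE /= => ->.
Qed.

Lemma rV3_neq0 x : x != 0 -> exists i, x 0 i != 0.
Proof.
move=> x0; apply/existsP; apply: contraNT x0 => /existsPn e.
by apply/eqP/rowP=> i; rewrite mxE; apply/eqP; have := e i; rewrite negbK.
Qed.

Lemma mul_rows3 c x y z :
  c *m rows3 x y z = c 0 o0 *: x + c 0 o1 *: y + c 0 o2 *: z.
Proof. by apply/rowP=> j; rewrite !mxE sum_ord3 !mxE. Qed.

Lemma dotE x y : x *m y^T = (dot x y)%:M.
Proof. by apply/rowP=> i; rewrite !mxE ord1 eqxx sum_ord3 !mxE. Qed.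

Lemma dotC x y : dot x y = dot y x.
Proof. rewrite /dot; ring. Qed.

Lemma dotDl x y u : dot (x + y) u = dot x u + dot y u.
Proof. rewrite /dot !mxE; ring. Qed.

Lemma dotBl x y u : dot (x - y) u = dot x u - dot y u.
Proof. rewrite /dot !mxE; ring. Qed.

Lemma dotZl k x u : dot (k *: x) u = k * dot x u.
Proof. rewrite /dot !mxE; ring. Qed.

Lemma dot0l u : dot 0 u = 0.
Proof. rewrite /dot !mxE; ring. Qed.

Lemma cross_vec a b c a' b' c' :
  cross (vec a b c) (vec a' b' c') =
  vec (b * c' - c * b') (c * a' - a * c') (a * b' - b * a').
Proof. by rewrite /cross !mxE. Qed.

Lemma dot_vec a b c a' b' c' :
  dot (vec a b c) (vec a' b' c') = a * a' + b * b' + c * c'.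
Proof. by rewrite /dot !mxE. Qed.

Lemma crossC x y : cross x y = - cross y x.
Proof. by apply: vecP; rewrite !mxE /=; ring. Qed.

Lemma crossxx x : cross x x = 0.
Proof. by apply: vecP; rewrite !mxE /=; ring. Qed.

Lemma crossZl k x y : cross (k *: x) y = k *: cross x y.
Proof. by apply: vecP; rewrite !mxE /=; ring. Qed.

Lemma crossZr k x y : cross x (k *: y) = k *: cross x y.
Proof. by apply: vecP; rewrite !mxE /=; ring. Qed.

Lemma crossDl x y z : cross (x + y) z = cross x z + cross y z.
Proof. by apply: vecP; rewrite !mxE /=; ring. Qed.

Lemma crossBl x y z : cross (x - y) z = cross x z - cross y z.
Proof. by apply: vecP; rewrite !mxE /=; ring. Qed.

Lemma cross0l y : cross 0 y = 0.
Proof. by apply: vecP; rewrite !mxE /=; ring. Qed.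

Lemma dot_crossl x y : dot x (cross x y) = 0.
Proof. rewrite /dot !mxE /=; ring. Qed.

Lemma dot_crossr x y : dot y (cross x y) = 0.
Proof. rewrite /dot !mxE /=; ring. Qed.

(** If [x] lies on the lines with coordinates [u] and [v], the right side vanishes, so [x] is
    proportional to [cross u v]. This gives uniqueness of the meet of two lines. *)
Lemma triple_cross x u v :
  cross x (cross u v) = dot x v *: u - dot x u *: v.
Proof. by apply: vecP; rewrite /dot !mxE /=; ring. Qed.

(** Geometrically, the joins of [z] with [x] and with [y] meet in [z]. For dependent [x], [y], [z]
    the factor is zero, and the two inner cross products are parallel; this is the form used to
    compare them. *)
Lemma cross_common x y z : cross (cross x z) (cross y z) = dot x (cross y z) *: z.
Proof. by apply: vecP; rewrite /dot !mxE /=; ring. Qed.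

Lemma cross_eq0 x y : x != 0 -> cross x y = 0 -> exists k, y = k *: x.
Proof.
move=> /rV3_neq0[i xi] /rowP e.
have := e o0; have := e o1; have := e o2; rewrite !mxE /=.
move=> /subr0_eq e2 /subr0_eq e1 /subr0_eq e0.
(* All 2 by 2 minors vanish, so the nonzero coordinate [i] fixes the ratio. *)
have key j : x 0 i * y 0 j = x 0 j * y 0 i.
  by move: i j {xi}; elim/ord3_ind; elim/ord3_ind.
by exists (y 0 i / x 0 i); apply/rowP=> j;
  rewrite mxE mulrAC (mulrC (y 0 i)) -key mulrC mulKf.
Qed.

(** The scalar is the determinant. Dotting a linear relation between the rows with the cross product
    of two of them leaves the determinant times the third coefficient. *)
Lemma rows3_unit x y z : dot x (cross y z) != 0 -> rows3 x y z \in unitmx.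
Proof.
move=> d; rewrite -row_free_unit -kermx_eq0; apply/rowV0P=> c /sub_kermxP.
rewrite mul_rows3 => e.
have d1 : dot y (cross z x) = dot x (cross y z).
  by rewrite /dot !mxE /=; ring.
have d2 : dot z (cross x y) = dot x (cross y z).
  by rewrite /dot !mxE /=; ring.
have k u : c 0 o0 * dot x u + c 0 o1 * dot y u + c 0 o2 * dot z u = 0.
  by rewrite -!dotZl -!dotDl e dot0l.
have := k (cross y z); have := k (cross z x); have := k (cross x y).
rewrite !dot_crossl !dot_crossr d1 d2 !mulr0 !addr0 !add0r.
do 3!(move=> /eqP; rewrite mulf_eq0 (negPf d) orbF => /eqP ?).
by apply: vecP; rewrite mxE.
Qed.

(** [u] is the vector of dual coordinates of the line; the kernel form yields its dimension by
    rank-nullity. *)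
Definition line_of u : {vspace 'rV[K]_3} :=
  lker (linfun (mulmxr u^T : 'rV[K]_3 -> 'rV[K]_1)).

Lemma mem_line_of u x : (x \in line_of u) = (dot x u == 0).
Proof.
rewrite memv_ker lfunE /= dotE; apply/eqP/eqP => [/rowP/(_ 0)|->].
  by rewrite !mxE eqxx.
by rewrite raddf0.
Qed.

End Coordinates.


(** * Points and lines of PG(2,K) in homogeneous coordinates *)

Section Lines.
Variable K : fieldType.
Implicit Types (x y z u v : 'rV[K]_3) (k : K) (l : {vspace 'rV[K]_3}).

Lemma dim_line_of u : u != 0 -> \dim (line_of u) = 2%N.
Proof.
move=> u0; set f := linfun (mulmxr u^T : 'rV[K]_3 -> 'rV[K]_1).
have f0 : (0 < \dim (limg f))%N.
  rewrite lt0n dimv_eq0; have [i ui] := rV3_neq0 u0.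
  apply/eqP=> f0; have : f (delta_mx 0 i) \in limg f by rewrite memv_img ?memvf.
  rewrite f0 memv0 lfunE /= => /eqP/rowP/(_ 0); rewrite -rowE !mxE => e.
  by rewrite e eqxx in ui.
have f1 : (\dim (limg f) <= 1)%N.
  by rewrite (leq_trans (dimvS (subvf _))) // dimvf dim_matrix.
have := limg_ker_dim f fullv; rewrite capfv dimvf dim_matrix -/(line_of u).
have -> : \dim (limg f) = 1%N by apply/eqP; rewrite eqn_leq f1.
by rewrite addn1 => -[].
Qed.

Lemma dim2_line_of l x y :
  \dim l = 2%N -> x \in l -> y \in l -> cross x y != 0 -> l = line_of (cross x y).
Proof.
move=> dl xl yl c0; apply/esym/eqP; rewrite eq_sym eqEdim dim_line_of // dl leqnn andbT.
have x0 : x != 0 by apply: contraNneq c0 => ->; rewrite cross0l.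
have xy : \dim (<[x]> + <[y]>) = 2%N.
  rewrite dimv_disjoint_sum ?dim_vline ?x0.
    case: eqP => // y0; move: c0; rewrite y0 crossC cross0l oppr0 eqxx //.
  apply/eqP; rewrite -subv0; apply/subvP=> z; rewrite memv_cap.
  case/andP=> /vlineP[a ->] /vlineP[b e]; rewrite memv0.
  have : cross x (a *: x) = b *: cross x y by rewrite e crossZr.
  rewrite crossZr crossxx scaler0 => /esym/eqP.
  by rewrite scaler_eq0 (negPf c0) orbF e => /eqP ->; rewrite scale0r.
have -> : l = (<[x]> + <[y]>)%VS.
  apply/esym/eqP; rewrite eqEdim dl xy leqnn andbT.
  by apply/subvP=> _ /memv_addP[_ /vlineP[a ->] [_ /vlineP[b ->] ->]];
    rewrite memvD ?memvZ.
apply/subvP=> _ /memv_addP[_ /vlineP[a ->] [_ /vlineP[b ->] ->]].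
by rewrite memvD // memvZ // mem_line_of ?dot_crossl ?dot_crossr.
Qed.

Lemma dim1_vline l : \dim l = 1%N -> exists2 x, x != 0 & l = <[x]>%VS.
Proof.
move=> d; have p0 : vpick l != 0 by rewrite vpick0 -dimv_eq0 d.
exists (vpick l) => //; apply/esym/eqP.
by rewrite eqEdim d dim_vline p0 -memvE memv_pick.
Qed.

Lemma dim2_cross_neq0 l : \dim l = 2%N ->
  exists x y, [/\ x \in l, y \in l & cross x y != 0].
Proof.
move=> d; have [x xl x0] : exists2 x, x \in l & x != 0.
  by exists (vpick l); rewrite ?memv_pick // vpick0 -dimv_eq0 d.
have : ~~ (l <= <[x]>)%VS by apply/negP=> /dimvS; rewrite d dim_vline x0.
case/subvPn=> y yl yx; exists x, y; split=> //; apply: contraNneq yx.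
by case/(cross_eq0 x0) => k ->; rewrite memvZ ?memv_line.
Qed.

Lemma dim2_is_line_of l : \dim l = 2%N -> exists2 u, u != 0 & l = line_of u.
Proof.
move=> d; have [x [y [xl yl c]]] := dim2_cross_neq0 d.
by exists (cross x y); last exact: dim2_line_of.
Qed.

Lemma vline_eqP x y : x != 0 -> y != 0 -> reflect (<[x]>%VS = <[y]>%VS) (cross x y == 0).
Proof.
move=> x0 y0; apply: (iffP eqP) => [/(cross_eq0 x0)[k e] | e].
  have k0 : k != 0 by apply: contraNneq y0 => k0; rewrite e k0 scale0r.
  apply/esym/eqP; rewrite eqEdim !dim_vline x0 y0 leqnn andbT e -memvE.
  by rewrite memvZ ?memv_line.
have /vlineP[k ->] : y \in <[x]>%VS by rewrite e memv_line.
by rewrite crossZr crossxx scaler0.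
Qed.

Lemma vlineZ k x : k != 0 -> <[k *: x]>%VS = <[x]>%VS.
Proof.
move=> k0; apply/eqP; rewrite eqEdim !dim_vline scaler_eq0 (negPf k0) leqnn andbT.
by rewrite -memvE memvZ ?memv_line.
Qed.

Lemma vline_le_line_of x u : (<[x]> <= line_of u)%VS = (dot x u == 0).
Proof. by rewrite -memvE mem_line_of. Qed.

(** For every [t] the vector [cross t u] is on the common line, and its dot product with [v] is that
    of [t] with [cross u v]. Unit vectors [t] then show that each coordinate of [cross u v] is
    zero. *)
Lemma line_of_inj u v : line_of u = line_of v -> cross u v = 0.
Proof.
move=> e; have d t : dot t (cross u v) = 0.
  have : cross t u \in line_of v by rewrite -e mem_line_of dotC dot_crossr.
  by rewrite mem_line_of => /eqP <-; rewrite /dot !mxE /=; ring.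
have dv a b c := d (vec a b c).
have := dv 1 0 0; have := dv 0 1 0; have := dv 0 0 1.
rewrite /dot !(mxE, mul0r, mul1r, addr0, add0r) /= => e2 e1 e0.
by apply: vecP; rewrite !mxE.
Qed.

End Lines.

(** * Invariance of subplanes under GL(3,K) *)

Section Invariance.
Variable (T U : finType) (I : T -> U -> bool) (f : T -> T) (h : U -> U).
Hypotheses (fI : injective f) (hI : injective h).
Hypothesis fhI : forall x l, I (f x) (h l) = I x l.

Lemma projective_plane_of_order_imset (P : {set T}) (L : {set U}) n :
  projective_plane_of_order I P L n ->
  projective_plane_of_order I (f @: P) (h @: L) n.
Proof.
have setL (p : pred U) : [set l in h @: L | p l] = h @: [set l in L | p (h l)].
  apply/setP=> l; rewrite inE; apply/andP/imsetP.
    by case=> /imsetP[m mL ->] pm; exists m; rewrite // inE mL.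
  by case=> m; rewrite inE => /andP[mL pm] ->; rewrite imset_f.
have setP (A : {set T}) (p : pred T) :
    [set x in f @: A | p x] = f @: [set x in A | p (f x)].
  apply/setP=> l; rewrite inE; apply/andP/imsetP.
    by case=> /imsetP[m mL ->] pm; exists m; rewrite // inE mL.
  by case=> m; rewrite inE => /andP[mL pm] ->; rewrite imset_f.
case/and4P=> /forall_inP c1 /forall_inP c2 /existsP[A /and3P[AP A4 /forall_inP A2]].
move=> /forall_inP c4; apply/and4P; split.
- apply/forall_inP=> _ /imsetP[x xP ->]; apply/forall_inP=> _ /imsetP[y yP ->].
  rewrite (inj_eq fI) setL card_imset //.
  by under eq_finset do rewrite !fhI; apply: (forall_inP (c1 x xP)).
- apply/forall_inP=> _ /imsetP[x xP ->]; apply/forall_inP=> _ /imsetP[y yP ->].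
  rewrite (inj_eq hI) setP card_imset //.
  by under eq_finset do rewrite !fhI; apply: (forall_inP (c2 x xP)).
- apply/existsP; exists (f @: A); rewrite imsetS // card_imset // A4 /=.
  apply/forall_inP=> _ /imsetP[l lL ->]; rewrite setP card_imset //.
  by under eq_finset do rewrite !fhI; apply: A2.
- apply/forall_inP=> _ /imsetP[l lL ->]; rewrite setP card_imset //.
  by under eq_finset do rewrite !fhI; apply: c4.
Qed.
End Invariance.

Notation GLmap g := (fun U => GLimg U g).

Section GLimgTheory.
Variable K : finFieldType.
Implicit Types (U V : {vspace 'rV[K]_3}) (g : {'GL_3[K]}) (B : {set {vspace 'rV[K]_3}}).

Lemma GLimg_inj g : injective (GLmap g).
Proof. exact: (act_inj (GLact K)). Qed.

Lemma GLimgK g U : GLimg (GLimg U g) g^-1%g = U.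
Proof. exact: (actK (GLact K)). Qed.

Lemma GLimgKV g U : GLimg (GLimg U g^-1%g) g = U.
Proof. exact: (actKV (GLact K)). Qed.

Lemma GLimgS g U V : (GLimg U g <= GLimg V g)%VS = (U <= V)%VS.
Proof.
apply/idP/idP; last exact: limgS.
by move/(limgS (linfun (mulmxr (GLval g^-1%g)))); rewrite -!/(GLimg _ _) !GLimgK.
Qed.

Lemma GLimg_vline g (x : 'rV[K]_3) : GLimg <[x]> g = <[x *m GLval g]>%VS.
Proof. by rewrite /GLimg limg_line lfunE. Qed.

Lemma dim_GLimg g U : \dim (GLimg U g) = \dim U.
Proof.
have le V h : (\dim (GLimg V h) <= \dim V)%N.
  by rewrite -(limg_ker_dim (linfun (mulmxr (GLval h))) V) leq_addl.
by apply/eqP; rewrite eqn_leq le -{1}(GLimgK g U) le.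
Qed.

Lemma mem_GLimgset g B U : (GLimg U g \in GLmap g @: B) = (U \in B).
Proof. exact: (mem_imset _ _ (@GLimg_inj g)). Qed.

Lemma GLimgset_points_on g l :
  GLmap g @: points_on l = points_on (GLimg l g).
Proof.
apply/setP=> V; rewrite -(GLimgKV g V) mem_GLimgset !inE.
by rewrite GLimgS dim_GLimg GLimgKV.
Qed.

Lemma card_GLimgset g B : #|GLmap g @: B| = #|B|.
Proof. by rewrite card_imset //; apply: GLimg_inj. Qed.

Lemma GLimgsetI g (B C : {set {vspace 'rV[K]_3}}) :
  GLmap g @: (B :&: C) = (GLmap g @: B) :&: (GLmap g @: C).
Proof. by apply: imsetI => ? ? _ _; apply: GLimg_inj. Qed.

Lemma GLimgsetM g h B : GLmap (g * h)%g @: B = GLmap h @: (GLmap g @: B).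
Proof.
by rewrite -imset_comp; apply: eq_imset => U; apply: (actM (GLact K)).
Qed.

Lemma GLimgsetKV g B : GLmap g @: (GLmap g^-1%g @: B) = B.
Proof.
rewrite -imset_comp (eq_imset (g := id)) ?imset_id //.
exact: (actKV (GLact K)).
Qed.

Lemma subplane_GLimg n B g :
  subplane_of_order n B -> subplane_of_order n (GLmap g @: B).
Proof.
case/andP=> BP pp; apply/andP; split.
  apply/subsetP=> _ /imsetP[U UB ->]; rewrite inE dim_GLimg.
  by have := subsetP BP U UB; rewrite inE.
(* The lines of a subplane are defined from its points, so those of the image have to be recognised
   as the images of the old ones. *)
have -> : [set l in PGlines K | (1 < #|GLmap g @: B :&: points_on l|)%N]
    = GLmap g @: [set l in PGlines K | (1 < #|B :&: points_on l|)%N].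
  apply/setP=> l; rewrite -(GLimgKV g l) mem_GLimgset !inE dim_GLimg.
  by rewrite -GLimgset_points_on -GLimgsetI card_GLimgset.
apply: projective_plane_of_order_imset pp; [exact: GLimg_inj | exact: GLimg_inj |].
exact: GLimgS.
Qed.

End GLimgTheory.


(** * The subfield F of order q and the standard subplane PG(2,F) *)

Definition fixedF (K : finFieldType) (n : nat) : {set K} := [set a | a ^+ n == a].

Section FixedField.
Variables (q : nat) (K : finFieldType).
Hypotheses (hq : prime_power q) (hK : #|K| = (q ^ 3)%N).

Notation F := (fixedF K q).

Lemma prime_power_gt1 : (1 < q)%N.
Proof. by case: hq => p [e [pp e0 ->]]; rewrite -(expn0 p) ltn_exp2l ?prime_gt1. Qed.

Let q1 := prime_power_gt1.

(** As q is a power of the characteristic, a -> a^q is additive; closure of F under sums and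
    opposites rests on this. *)
Lemma pnat_pchar : ([pchar K]).-nat q.
Proof.
case: hq => p [e [pp e0 qE]].
have pK : p \in [pchar K] by apply: (@card_finPcharP _ p (e * 3)); rewrite // expnM -qE.
by rewrite (eq_pnat _ (pcharf_eq pK)) qE pnatX pnat_id.
Qed.

Lemma fixedF0 : 0 \in F. Proof. by rewrite inE expr0n; case: q q1. Qed.
Lemma fixedF1 : 1 \in F. Proof. by rewrite inE expr1n. Qed.
Lemma fixedFD a b : a \in F -> b \in F -> a + b \in F.
Proof. by rewrite !inE (exprDn_pchar _ _ pnat_pchar) => /eqP-> /eqP->. Qed.
Lemma fixedFN a : a \in F -> - a \in F.
Proof. by rewrite !inE (exprNn_pchar _ pnat_pchar) => /eqP->. Qed.
Lemma fixedFB a b : a \in F -> b \in F -> a - b \in F.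
Proof. by move=> aF bF; rewrite fixedFD ?fixedFN. Qed.
Lemma fixedFM a b : a \in F -> b \in F -> a * b \in F.
Proof. by rewrite !inE exprMn => /eqP-> /eqP->. Qed.
Lemma fixedFV a : a \in F -> a^-1 \in F.
Proof. by rewrite !inE exprVn => /eqP->. Qed.

Lemma card_fixedF_le : (#|F| <= q)%N.
Proof.
have s : size ('X^q - 'X : {poly K}) = q.+1.
  by rewrite size_polyDl size_polyXn // size_polyN size_polyX.
rewrite cardE -ltnS -s max_poly_roots ?enum_uniq -?size_poly_eq0 ?s //.
apply/allP=> a; rewrite mem_enum inE => /eqP e.
by rewrite rootE !hornerE e subrr.
Qed.

Lemma card_fixedF : #|F| = q.
Proof.
apply/eqP; rewrite eqn_leq card_fixedF_le /=.
(* For the lower bound, the complement of F is counted: (X^(q-1) - 1) h = X^(q^3-1) - 1, so every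
   element outside F is a root of [h], whose degree is at most (q-1)(q^2+q) = q^3 - q. *)
pose N := (q ^ 2 + q + 1)%N.
pose h : {poly K} := \sum_(i < N) 'X^(q.-1 * i).
(* The value at 0 is 1: only the term i = 0 survives, because q - 1 > 0. *)
have h0 : h != 0.
  apply/eqP=> e; have := congr1 (fun r : {poly K} => r.[0]) e.
  rewrite horner_sum horner0 /N addn1 big_ord_recl big1 ?hornerXn ?muln0 ?addr0.
    by apply/eqP; rewrite oner_eq0.
  by move=> i _; rewrite hornerXn expr0n muln_eq0 eqn0Ngt -subn1 subn_gt0 q1.
have sh : (size h <= (q ^ 3 - q).+1)%N.
  apply: (leq_trans (size_sum _ _ _)); apply/bigmax_leqP=> i _.
  rewrite size_polyXn ltnS; have := ltn_ord i; rewrite {2}/N addn1 ltnS => iN.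
  have : (q.-1 * i <= q.-1 * (q ^ 2 + q))%N by rewrite leq_mul2l iN orbT.
  move/leq_trans; apply; case: (q) q1 => // r _ /=; nia.
have hr : (#|~: F| <= q ^ 3 - q)%N.
  rewrite cardE -ltnS (leq_trans _ sh) // max_poly_roots ?enum_uniq //.
  apply/allP=> a; rewrite mem_enum 2!inE => aF.
  have a0 : a != 0 by apply: contraNneq aF => ->; rewrite expr0n; case: q q1.
  have aq : a ^+ q.-1 - 1 != 0.
    rewrite subr_eq0; apply: contraNneq aF => e.
    by rewrite -(ltn_predK q1) exprS e mulr1.
  rewrite rootE /h horner_sum -(inj_eq (mulfI aq)) mulr0.
  under eq_bigr => i _ do rewrite hornerXn exprM.
  rewrite -subrX1 -exprM subr_eq0 -(inj_eq (mulfI a0)) -exprS mulr1.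
  have -> : (q.-1 * N).+1 = #|K| by rewrite hK /N; case: (q) q1 => // r _ /=; nia.
  by rewrite expf_card.
have q3 : (q <= q ^ 3)%N by rewrite -{1}(expn1 q) leq_exp2l.
rewrite -(leq_add2r #|~: F|) cardsC hK.
by rewrite -[leqRHS](subnKC q3) leq_add2l.
Qed.

Implicit Types (x y z u : 'rV[K]_3) (P l : {vspace 'rV[K]_3}).

Definition Frational (x : 'rV[K]_3) := [forall i, x 0 i \in F].

Lemma FrationalP x : reflect (forall i, x 0 i \in F) (Frational x).
Proof. exact: forallP. Qed.

Lemma Frational_vec a b c : a \in F -> b \in F -> c \in F -> Frational (vec a b c).
Proof. by move=> aF bF cF; apply/FrationalP; elim/ord3_ind; rewrite mxE. Qed.

Lemma FrationalD x y : Frational x -> Frational y -> Frational (x + y).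
Proof. by move=> /FrationalP xF /FrationalP yF; apply/FrationalP=> i; rewrite mxE fixedFD. Qed.

Lemma FrationalB x y : Frational x -> Frational y -> Frational (x - y).
Proof.
by move=> /FrationalP xF /FrationalP yF; apply/FrationalP=> i; rewrite !mxE fixedFB.
Qed.

Lemma FrationalZ k x : k \in F -> Frational x -> Frational (k *: x).
Proof. by move=> kF /FrationalP xF; apply/FrationalP=> i; rewrite mxE fixedFM. Qed.

Lemma Frational_cross x y : Frational x -> Frational y -> Frational (cross x y).
Proof.
by move=> /FrationalP xF /FrationalP yF; apply: Frational_vec; rewrite fixedFB ?fixedFM.
Qed.

Lemma FrationalZ_inv k x : x != 0 -> Frational x -> Frational (k *: x) -> k \in F.
Proof.
case/rV3_neq0=> i xi /FrationalP xF /FrationalP kx.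
by rewrite -(mulfK xi k) fixedFM ?fixedFV //; have := kx i; rewrite mxE.
Qed.

(* Locked so that inE does not unfold membership. *)
Definition stdplane : {set {vspace 'rV[K]_3}} :=
  locked [set P | [exists x : 'rV[K]_3, [&& Frational x, x != 0 & P == <[x]>%VS]]].

Lemma stdplaneP P :
  reflect (exists x, [/\ Frational x, x != 0 & P = <[x]>%VS]) (P \in stdplane).
Proof.
rewrite /stdplane -lock inE; apply: (iffP existsP) => -[x].
  by case/and3P=> xr x0 /eqP ->; exists x.
by case=> xr x0 ->; exists x; rewrite xr x0 eqxx.
Qed.

Lemma mem_stdplane x : Frational x -> x != 0 -> <[x]>%VS \in stdplane.
Proof. by move=> xr x0; apply/stdplaneP; exists x. Qed.

Lemma stdplane_line l : l \in PGlines K ->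
    (1 < #|stdplane :&: points_on l|)%N ->
  exists x y, [/\ Frational x, Frational y, cross x y != 0 & l = line_of (cross x y)].
Proof.
rewrite inE => /eqP dl /card_gt1P[P [Q [PB QB PQ]]].
move: PB; rewrite !inE => /andP[/stdplaneP[x [xr x0 Px]] /andP[_ Pl]].
move: QB; rewrite !inE => /andP[/stdplaneP[y [yr y0 Qy]] /andP[_ Ql]].
have c : cross x y != 0.
  by apply: contraNN PQ => /(vline_eqP x0 y0) e; rewrite Px Qy e.
exists x, y; split=> //; apply: dim2_line_of => //.
  by rewrite memvE -Px.
by rewrite memvE -Qy.
Qed.

(** Joins and meets are cross products, and these preserve F-rationality; so the axioms are checked
    on rational representatives. *)
Lemma subplane_stdplane : subplane_of_order q stdplane.
Proof.
have BP : stdplane \subset PGpoints K.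
  by apply/subsetP=> P /stdplaneP[x [_ x0 ->]]; rewrite inE dim_vline x0.
rewrite /subplane_of_order BP andTb; apply/and4P; split.
- apply/forall_inP=> _ /stdplaneP[x [xr x0 ->]].
  apply/forall_inP=> _ /stdplaneP[y [yr y0 ->]]; apply/implyP=> xy.
  have c : cross x y != 0 by apply: contraNN xy => /(vline_eqP x0 y0)/eqP.
  apply/cards1P; exists (line_of (cross x y)); apply/setP=> l; rewrite !inE.
  apply/andP/eqP => [[/andP[/eqP dl _] /andP[xl yl]] | ->].
    by apply: dim2_line_of; rewrite ?memvE.
  rewrite !vline_le_line_of dot_crossl dot_crossr eqxx dim_line_of //; split=> //.
  apply/andP; split=> //; apply/card_gt1P; exists <[x]>%VS, <[y]>%VS.
  by rewrite xy !inE !vline_le_line_of !dim_vline x0 y0 dot_crossl dot_crossr eqxx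
    !mem_stdplane.
- apply/forall_inP=> l; rewrite inE => /andP[lL l2].
  apply/forall_inP=> m; rewrite inE => /andP[mL m2]; apply/implyP=> lm.
  have [x [y [xr yr c lE]]] := stdplane_line lL l2.
  have [z [w [zr wr c' mE]]] := stdplane_line mL m2.
  set u := cross x y in c lE; set v := cross z w in c' mE.
  have ur : Frational u by apply: Frational_cross.
  have vr : Frational v by apply: Frational_cross.
  have p0 : cross u v != 0.
    apply: contraNneq lm => e; have [k vk] := cross_eq0 c e.
    apply/eqP; rewrite lE mE vk; apply/vspaceP=> t; rewrite !mem_line_of !(dotC t) dotZl.
    have k0 : k != 0 by apply: contraNneq c' => k0; rewrite vk k0 scale0r.
    by rewrite mulf_eq0 (negPf k0).
  apply/cards1P; exists <[cross u v]>%VS; apply/setP=> P; rewrite !inE.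
  apply/andP/eqP => [[/stdplaneP[t [tr t0 ->]]]|->].
    rewrite lE mE !vline_le_line_of => /andP[/eqP tu /eqP tv].
    by apply/vline_eqP; rewrite // triple_cross tu tv !scale0r subr0.
  split; first by rewrite mem_stdplane ?Frational_cross.
  by rewrite lE mE !vline_le_line_of (dotC _ u) (dotC _ v) dot_crossl dot_crossr eqxx.
(* The standard frame is the required quadrangle. *)
- pose s : seq {vspace 'rV[K]_3} :=
    [:: <[vec 1 0 0]>; <[vec 0 1 0]>; <[vec 0 0 1]>; <[vec 1 1 1]>]%VS.
  have n0 : [&& vec 1 0 0 != 0 :> 'rV[K]_3, vec 0 1 0 != 0 :> 'rV[K]_3,
      vec 0 0 1 != 0 :> 'rV[K]_3 & vec 1 1 1 != 0 :> 'rV[K]_3].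
    by rewrite !vec_eq0 !(eqxx, oner_eq0).
  case/and4P: n0 => n1 n2 n3 n4.
  apply/existsP; exists [set P in s]; apply/and3P; split.
  + apply/subsetP=> P; rewrite !inE.
    by case/or4P=> /eqP->; rewrite mem_stdplane ?Frational_vec ?fixedF0 ?fixedF1.
  + have ne (x y : 'rV[K]_3) : x != 0 -> y != 0 -> cross x y != 0 ->
        (<[x]>%VS == <[y]>%VS) = false.
      by move=> x0 y0 c; apply/eqP=> /vline_eqP e; move: c; rewrite e.
    rewrite cardsE; apply/eqP/card_uniqP; rewrite cons_uniq cons_uniq cons_uniq.
    rewrite !in_cons !in_nil !ne // cross_vec vec_eq0.
    1-6: by rewrite ?(mulr0, mul0r, mul1r, subr0, sub0r, subrr, oppr_eq0, oner_eq0, eqxx).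
  apply/forall_inP=> l; rewrite inE => /andP[]; rewrite inE => /eqP/dim2_is_line_of[u u0 ->] _.
  have -> : [set P in [set P in s] | (P <= line_of u)%VS]
     = [set P in [seq P <- s | (P <= line_of u)%VS]].
    by apply/setP=> P; rewrite !inE mem_filter !inE andbC.
  rewrite cardsE (leq_trans (card_size _)) //= !vline_le_line_of.
  rewrite /dot !mxE /= !(mul0r, mul1r, addr0, add0r).
  move: u0; rewrite (vecE u) vec_eq0 !mxE /=.
  (* A unit vector is on the line exactly when the matching coordinate of [u] is zero. Two zero
     coordinates force the third to be nonzero, and then (1,1,1) is off the line. *)
  have [->|a0] := eqVneq (u 0 o0) 0; have [->|b0] := eqVneq (u 0 o1) 0;
  have [->|c0] := eqVneq (u 0 o2) 0;
    rewrite ?addr0 ?add0r //= ?(negPf a0) ?(negPf b0) ?(negPf c0) //=;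
    first [by [] | by case: ifP].
- apply/forall_inP=> l; rewrite inE => /andP[lL l2].
  have [x [y [xr yr c ->]]] := stdplane_line lL l2.
  have x0 : x != 0 by apply: contraNneq c => ->; rewrite cross0l.
  have y0 : y != 0 by apply: contraNneq c => ->; rewrite crossC cross0l oppr0.
  have xt0 t : x + t *: y != 0.
    apply: contraNneq c => /(congr1 (fun v => cross v y)).
    by rewrite crossDl crossZl crossxx scaler0 addr0 cross0l => ->.
  (* The q + 1 rational points on the join of [x] and [y]: [y] itself, and one point for each
     parameter in F. *)
  have -> : [set P in stdplane | (P <= line_of (cross x y))%VS] =
     <[y]>%VS |: [set <[x + t *: y]>%VS | t in F].
    apply/setP=> P; rewrite inE; apply/andP/setU1P.
      case=> /stdplaneP[z [zr z0 ->]]; rewrite vline_le_line_of => /eqP d.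
      have [e|zy] := eqVneq (cross z y) 0; first by left; apply/vline_eqP; rewrite ?e.
      (* Collinearity gives [cross z y] = k [cross x y], with k in F as a ratio of rational vectors.
         Then z/k - x has zero cross product with y, hence is a multiple of y, and its factor is the
         parameter sought. *)
      right; have := cross_common z x y; rewrite d scale0r => e.
      have e' : cross (cross x y) (cross z y) = 0 by rewrite crossC e oppr0.
      have [k zk] := cross_eq0 c e'.
      have kF : k \in F by apply: (FrationalZ_inv c); rewrite -?zk ?Frational_cross.
      have k0 : k != 0 by apply: contraNneq zy => k0; rewrite zk k0 scale0r.
      have e2 : cross y (k^-1 *: z - x) = 0.
        by rewrite crossC crossBl crossZl zk scalerA mulVf // scale1r subrr oppr0.
      have [t te] := cross_eq0 y0 e2.
      apply/imsetP; exists t.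
        by apply: (FrationalZ_inv y0); rewrite -?te ?FrationalB ?FrationalZ ?fixedFV.
      by rewrite -te addrC subrK vlineZ // invr_eq0.
    case=> [->|/imsetP[t tF ->]].
      by rewrite mem_stdplane // vline_le_line_of dot_crossr.
    by rewrite mem_stdplane ?FrationalD ?FrationalZ // vline_le_line_of dotDl dotZl
      dot_crossl dot_crossr mulr0 addr0.
  rewrite cardsU1 card_in_imset ?card_fixedF; last first.
    move=> s t _ _ /vline_eqP e; have /eqP := e (xt0 s) (xt0 t).
    have -> : cross (x + s *: y) (x + t *: y) = (t - s) *: cross x y.
      by apply: vecP; rewrite !mxE /=; ring.
    by move/eqP; rewrite scaler_eq0 (negPf c) orbF subr_eq0 => /eqP.
  suff -> : <[y]>%VS \notin [set <[x + t *: y]>%VS | t in F] by rewrite add1n.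
  apply/imsetP=> -[t _ /vline_eqP e]; have := e y0 (xt0 t); apply/negP.
  have -> : cross y (x + t *: y) = - cross x y.
    by apply: vecP; rewrite !mxE /=; ring.
  by rewrite oppr_eq0.
Qed.

End FixedField.


(** * A subplane of order q containing the standard frame is PG(2,F) *)

Section Coordinatization.
Variables (q : nat) (K : finFieldType) (B : {set {vspace 'rV[K]_3}}).
Hypotheses (hq : prime_power q) (Bq : subplane_of_order q B).
Implicit Types (x y z w p : 'rV[K]_3) (a b k : K).

Lemma subplane_neq0 x : <[x]>%VS \in B -> x != 0.
Proof.
case/andP: Bq => /subsetP BP _ /BP; by rewrite inE dim_vline eqb1.
Qed.

Lemma subplane_vline P : P \in B -> exists2 x, x != 0 & P = <[x]>%VS.
Proof.
by move=> PB; apply: dim1_vline; case/andP: Bq => /subsetP/(_ P PB); rewrite inE => /eqP.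
Qed.

Lemma subplane_line_of x y : <[x]>%VS \in B -> <[y]>%VS \in B -> cross x y != 0 ->
  line_of (cross x y) \in [set l in PGlines K | (1 < #|B :&: points_on l|)%N].
Proof.
move=> xB yB c; rewrite !inE dim_line_of // eqxx /=.
have x0 := subplane_neq0 xB; have y0 := subplane_neq0 yB.
apply/card_gt1P; exists <[x]>%VS, <[y]>%VS.
have xy : <[x]>%VS != <[y]>%VS by apply: contraNneq c => /(vline_eqP x0 y0).
by rewrite !inE xB yB !dim_vline x0 y0 !vline_le_line_of dot_crossl dot_crossr eqxx.
Qed.

(** A nonzero double cross product means that the two joins are distinct lines of the subplane, so
    they share a point of [B], which [triple_cross] identifies. The scalar [k] permits a normalised
    representative [p]. *)
Lemma subplane_meet k p x y z w :
    <[x]>%VS \in B -> <[y]>%VS \in B -> <[z]>%VS \in B -> <[w]>%VS \in B ->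
    k != 0 -> p != 0 -> cross (cross x y) (cross z w) = k *: p ->
  <[p]>%VS \in B.
Proof.
move=> xB yB zB wB k0 p0 e.
have c0 : cross (cross x y) (cross z w) != 0 by rewrite e scaler_eq0 negb_or k0.
have cxy : cross x y != 0 by apply: contraNneq c0 => ->; rewrite cross0l.
have czw : cross z w != 0 by apply: contraNneq c0 => ->; rewrite crossC cross0l oppr0.
have lm : line_of (cross x y) != line_of (cross z w).
  by apply: contraNneq c0 => /line_of_inj ->.
case/andP: (Bq) => _ /and4P[_ /forall_inP c2 _ _].
have := forall_inP (c2 _ (subplane_line_of xB yB cxy)) _ (subplane_line_of zB wB czw).
rewrite lm /= => /cards1P[Q /setP/(_ Q)]; rewrite in_set1 eqxx in_set => /andP[QB].
have [t t0 QE] := subplane_vline QB.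
rewrite QE !vline_le_line_of => /andP[/eqP tu /eqP tv].
suff <- : Q = <[p]>%VS by [].
rewrite QE -(vlineZ p k0) -e; apply/vline_eqP; rewrite ?c0 //.
by rewrite triple_cross tu tv !scale0r subr0.
Qed.

Hypotheses (e1B : <[vec 1 0 0]>%VS \in B) (e2B : <[vec 0 1 0]>%VS \in B).
Hypotheses (e3B : <[vec 0 0 1]>%VS \in B) (uB : <[vec 1 1 1]>%VS \in B).

(** Every incidence needed below is a polynomial identity up to sign, and the target has a
    coordinate equal to 1, hence is nonzero. *)
Ltac meet_up_to k hx hy hz hw :=
  apply: (subplane_meet (k := k) hx hy hz hw);
  rewrite ?oppr_eq0 ?oner_eq0 ?vec_eq0 ?oppr_eq0 ?oner_eq0 ?andbF //;
  rewrite !cross_vec; apply: vecP; rewrite !mxE /=; ring.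
Ltac meet_by hx hy hz hw :=
  first [meet_up_to (1 : K) hx hy hz hw | meet_up_to (-1 : K) hx hy hz hw].

Let p101 : <[vec 1 0 1]>%VS \in B. Proof. meet_by e1B e3B e2B uB. Qed.
Let p011 : <[vec 0 1 1]>%VS \in B. Proof. meet_by e2B e3B e1B uB. Qed.
Let pdiag : <[vec 1 (-1) 0]>%VS \in B. Proof. meet_by p101 p011 e1B e2B. Qed.

Let R := [set a | <[vec a 0 1]>%VS \in B].

(** Projection from (1,-1,0) exchanges the axes Y = 0 and X = 0, as (a,0,1) - a(1,-1,0) =
    (0,a,1). *)
Let swapP a : (a \in R) = (<[vec 0 a 1]>%VS \in B).
Proof.
rewrite inE; apply/idP/idP => aB; first meet_by aB pdiag e2B e3B.
meet_by aB pdiag e1B e3B.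
Qed.

(** Projections from (0,1,0) and (1,0,0) read off the coordinates; conversely the point is the meet
    of a vertical and a horizontal line. *)
Let affineP a b : (<[vec a b 1]>%VS \in B) = (a \in R) && (b \in R).
Proof.
apply/idP/andP => [abB|[]].
  split; first by rewrite inE; meet_by abB e2B e1B e3B.
  by rewrite swapP; meet_by abB e1B e2B e3B.
by rewrite [b \in R]swapP inE => aB bB; meet_by aB e2B bB e1B.
Qed.

Let R0 : 0 \in R. Proof. by rewrite inE. Qed.
Let R1 : 1 \in R. Proof. by rewrite inE. Qed.

(** (1,b,0) is the direction of the line through the origin (0,0,1) and the affine point (1,b,1). *)
Let infinityP b : (<[vec 1 b 0]>%VS \in B) = (b \in R).
Proof.
have -> : (b \in R) = (<[vec 1 b 1]>%VS \in B) by rewrite affineP R1.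
apply/idP/idP => bB; first meet_by e3B bB e2B p101.
meet_by e3B bB e1B e2B.
Qed.

(** The line Y = bX through the origin meets the vertical X = a in (a, ab). *)
Let RM a b : a \in R -> b \in R -> a * b \in R.
Proof.
move=> aR bR; have abB : <[vec a (a * b) 1]>%VS \in B; last first.
  by move: abB; rewrite affineP => /andP[].
move: aR bR; rewrite -[b \in R]infinityP inE => aB bB; meet_by e3B bB aB e2B.
Qed.

Let vec01_inj : injective (fun a => <[vec a 0 1]>%VS : {vspace 'rV[K]_3}).
Proof.
move=> a b /vline_eqP; rewrite cross_vec !vec_eq0 !oner_eq0 !andbF.
case/(_ isT isT)/and3P=> _ + _.
by rewrite mul1r mulr1 subr_eq0 => /eqP.
Qed.

(** The axis Y = 0 carries q + 1 points of [B]: (1,0,0) and the points (a,0,1) with a in [R]. *)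
Let cardR : #|R| = q.
Proof.
case/andP: (Bq) => _ /and4P[_ _ _ /forall_inP c4].
have c : cross (vec 0 0 1) (vec 1 0 0) != 0 :> 'rV[K]_3.
  by rewrite cross_vec vec_eq0 !(mulr0, mul0r, mul1r, subr0, oner_eq0) andbF.
have := c4 _ (subplane_line_of e3B e1B c).
have -> : [set P in B | (P <= line_of (cross (vec 0 0 1) (vec 1 0 0)))%VS] =
    <[vec 1 0 0]>%VS |: [set <[vec a 0 1]>%VS | a in R].
  apply/setP=> P; rewrite inE; apply/andP/setU1P.
    case=> /[dup]PB/subplane_vline[x x0 PE].
    rewrite {1}PE vline_le_line_of {1}(vecE x) cross_vec dot_vec.
    rewrite !(mulr0, mul0r, mul1r, mulr1, subr0, add0r, addr0, oner_eq0) => /eqP x1.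
    have [x2|x2] := eqVneq (x 0 o2) 0.
      have x00 : x 0 o0 != 0.
        by apply: contraNneq x0 => e; rewrite (vecE x) e x1 x2 vec_eq0 eqxx.
      left; rewrite PE -(vlineZ (vec 1 0 0) x00); congr <[_]>%VS.
      by apply: vecP; rewrite !mxE /= ?x1 ?x2 ?mulr1 ?mulr0.
    right; have E : P = <[vec (x 0 o0 / x 0 o2)%R 0 1]>%VS.
      rewrite PE -(vlineZ (vec _ 0 1) x2); congr <[_]>%VS.
      by apply: vecP; rewrite !mxE /= ?x1 ?mulr1 ?mulr0 // mulrC divfK.
    by apply/imsetP; exists (x 0 o0 / x 0 o2); rewrite // inE -E.
  have d a b : dot (vec a 0 b) (cross (vec 0 0 1) (vec 1 0 0)) = 0.
    by rewrite cross_vec dot_vec; ring.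
  case=> [->|/imsetP[a aR ->]]; rewrite vline_le_line_of d eqxx //.
  by move: aR; rewrite inE.
rewrite cardsU1 card_imset //.
suff -> : <[vec 1 0 0]>%VS \notin [set <[vec a 0 1]>%VS | a in R].
  by rewrite add1n => /eqP[].
apply/imsetP=> -[a _ /vline_eqP]; rewrite cross_vec !vec_eq0 !oner_eq0 !andbF.
by move/(_ isT isT); rewrite !(mulr0, mul0r, mul1r, subr0, sub0r, oppr_eq0, oner_eq0) andbF.
Qed.

(** F has at most q elements, so the inclusion of [R] in F suffices. For nonzero a in [R],
    multiplication by a permutes the nonzero elements of [R]; comparing their products gives a^(q-1)
    = 1. *)
Let RE : R = fixedF K q.
Proof.
apply/eqP; rewrite eqEcard cardR card_fixedF_le // andbT.
apply/subsetP=> a aR; rewrite inE.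
have [->|a0] := eqVneq a 0.
  by rewrite expr0n; case: q (prime_power_gt1 hq).
pose S := R :\ 0.
have cS : #|S| = q.-1 by rewrite -cardR (cardsD1 0 R) R0.
have im : [set a * r | r in S] = S.
  apply/eqP; rewrite eqEcard card_imset ?leqnn ?andbT; last exact: mulfI.
  apply/subsetP=> _ /imsetP[r /setD1P[r0 rR] ->].
  by rewrite !in_setD1 mulf_neq0 //= RM.
have e : \prod_(r in S) r = a ^+ q.-1 * \prod_(r in S) r.
  rewrite -{1}im big_imset /=; last by move=> r s _ _; apply: mulfI.
  by rewrite big_split /= prodr_const cS.
have S0 : \prod_(r in S) r != 0.
  by apply/prodf_neq0=> r /setD1P[].
have /eqP a1 : 1 == a ^+ q.-1 by rewrite -(inj_eq (mulIf S0)) mul1r -e.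
by rewrite -(ltn_predK (prime_power_gt1 hq)) exprS -a1 mulr1.
Qed.

Lemma subplane_eq_stdplane : B = stdplane q K.
Proof.
have q1 := prime_power_gt1 hq.
have F0 := fixedF0 K hq.
(* Each point has a representative (a,b,1), (1,b,0) or (0,1,0), for which membership in [B] is
   already decided. *)
have key x : x != 0 -> exists x', [/\ x' != 0, <[x]>%VS = <[x']>%VS,
    Frational q x -> Frational q x' & (<[x']>%VS \in B) = Frational q x'].
  move=> x0; have [x2|x2] := eqVneq (x 0 o2) 0; last first.
    exists ((x 0 o2)^-1 *: x); rewrite scaler_eq0 invr_eq0 (negPf x2) x0.
    split=> // [|xr|]; first by rewrite vlineZ ?invr_eq0.
      by rewrite FrationalZ // fixedFV //; move/FrationalP: xr.
    have -> : (x 0 o2)^-1 *: x = vec ((x 0 o2)^-1 * x 0 o0) ((x 0 o2)^-1 * x 0 o1) 1.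
      by apply: vecP; rewrite !mxE //= mulVf.
    rewrite affineP RE; apply/andP/FrationalP => [[aF bF]|xr].
      by elim/ord3_ind; rewrite mxE //= fixedF1.
    by split; [have := xr o0 | have := xr o1]; rewrite mxE.
  have [x00|x00] := eqVneq (x 0 o0) 0; last first.
    exists ((x 0 o0)^-1 *: x); rewrite scaler_eq0 invr_eq0 (negPf x00) x0.
    split=> // [|xr|]; first by rewrite vlineZ ?invr_eq0.
      by rewrite FrationalZ // fixedFV //; move/FrationalP: xr.
    have -> : (x 0 o0)^-1 *: x = vec 1 ((x 0 o0)^-1 * x 0 o1) 0.
      by apply: vecP; rewrite !mxE ?x2 ?mulr0 //= mulVf.
    rewrite infinityP RE; apply/idP/FrationalP => [aF|xr].
      by elim/ord3_ind; rewrite mxE //= fixedF1.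
    by have := xr o1; rewrite mxE.
  have x1 : x 0 o1 != 0.
    by apply: contraNneq x0 => e; rewrite (vecE x) e x00 x2 vec_eq0 eqxx.
  have xE : x = x 0 o1 *: vec 0 1 0.
    by apply: vecP; rewrite !mxE /= ?mulr1 ?mulr0.
  have r2 : Frational q (vec 0 1 0 : 'rV[K]_3) by rewrite Frational_vec ?fixedF1.
  exists (vec 0 1 0); rewrite vec_eq0 oner_eq0 andbF e2B r2 {1}xE vlineZ //; split.
apply/setP=> P; apply/idP/stdplaneP => [PB|[x [xr x0 ->]]].
  have [x x0 PE] := subplane_vline PB.
  have [x' [x'0 xx' _ e]] := key x x0.
  by exists x'; rewrite x'0 PE xx' -e -xx' -PE.
have [x' [x'0 -> r e]] := key x x0.
by rewrite e r.
Qed.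

End Coordinatization.


(** * Moving a quadrangle to the standard frame, and a model line to any line *)

Section Frames.
Variable K : finFieldType.
Implicit Types (x y z u : 'rV[K]_3) (l : {vspace 'rV[K]_3}) (B : {set {vspace 'rV[K]_3}}).

Lemma unitmx_GLval (M : 'M[K]_3) : M \in unitmx -> exists g : {'GL_3[K]}, GLval g = M.
Proof. by move=> uM; exists (FinRing.unit _ (uM : M \is a GRing.unit)). Qed.

Lemma vline_preim_GLimg (g : {'GL_3[K]}) B x :
  (<[x]>%VS \in GLmap g^-1%g @: B) = (<[x *m GLval g]>%VS \in B).
Proof. by rewrite -GLimg_vline -(mem_GLimgset g) GLimgsetKV. Qed.

(** Three points of the quadrangle give a basis, and the fourth has only nonzero coordinates in it.
    Rescaling the basis vectors by these coordinates yields the rows of [g], which maps (1,1,1) to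
    the fourth point. *)
Lemma subplane_frame n B : subplane_of_order n B ->
  exists g : {'GL_3[K]}, [/\ <[vec 1 0 0]>%VS \in GLmap g^-1%g @: B,
    <[vec 0 1 0]>%VS \in GLmap g^-1%g @: B, <[vec 0 0 1]>%VS \in GLmap g^-1%g @: B
    & <[vec 1 1 1]>%VS \in GLmap g^-1%g @: B].
Proof.
move=> Bn; case/andP: (Bn) => _ /and4P[_ _ /existsP[A /and3P[AB A4 /forall_inP A2]] _].
have /subsetP sAB := AB.
have tri x y z : <[x]>%VS \in A -> <[y]>%VS \in A -> <[z]>%VS \in A ->
    <[x]>%VS != <[y]>%VS -> <[y]>%VS != <[z]>%VS -> <[z]>%VS != <[x]>%VS ->
    dot x (cross y z) != 0.
  move=> xA yA zA xy yz zx; apply/eqP=> e.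
  have c : cross y z != 0.
    by apply: contraNN yz => /(vline_eqP (subplane_neq0 Bn (sAB _ yA))
      (subplane_neq0 Bn (sAB _ zA)))/eqP.
  have := A2 _ (subplane_line_of Bn (sAB _ yA) (sAB _ zA) c).
  rewrite leqNgt => /negP[]; apply/card_gt2P; exists <[x]>%VS, <[y]>%VS, <[z]>%VS.
  by rewrite !inE xA yA zA !vline_le_line_of e dot_crossl dot_crossr eqxx.
have [P1 [P2 [P3 [P4 Aenum]]]] : exists P1 P2 P3 P4, enum A = [:: P1; P2; P3; P4].
  move: A4; rewrite cardE; case: (enum A) => [|P1 [|P2 [|P3 [|P4 [|//]]]]] // _.
  by exists P1, P2, P3, P4.
have inA P : (P \in A) = [|| P == P1, P == P2, P == P3 | P == P4].
  by rewrite -mem_enum Aenum !inE.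
have PA : [&& P1 \in A, P2 \in A, P3 \in A & P4 \in A] by rewrite !inA !eqxx !orbT.
case/and4P: PA => P1A P2A P3A P4A.
have := enum_uniq A; rewrite Aenum cons_uniq cons_uniq cons_uniq.
rewrite !in_cons !in_nil !orbF !negb_or.
case/and4P=> /and3P[n12 n13 n14] /andP[n23 n24] n34 _.
have [x1 _ E1] := subplane_vline Bn (sAB _ P1A).
have [x2 _ E2] := subplane_vline Bn (sAB _ P2A).
have [x3 _ E3] := subplane_vline Bn (sAB _ P3A).
have [x4 _ E4] := subplane_vline Bn (sAB _ P4A).
have PB : [&& P1 \in B, P2 \in B, P3 \in B & P4 \in B] by rewrite !sAB.
case/and4P: PB => P1B P2B P3B P4B.
rewrite {inA Aenum}E1 {}E2 {}E3 {}E4 in n12 n13 n14 n23 n24 n34 P1A P2A P3A P4A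
  P1B P2B P3B P4B.
have d := tri _ _ _ P1A P2A P3A n12 n23; rewrite eq_sym in d; have {}d := d n13.
have uM := rows3_unit d; pose c := x4 *m invmx (rows3 x1 x2 x3).
have x4E : x4 = c 0 o0 *: x1 + c 0 o1 *: x2 + c 0 o2 *: x3.
  by rewrite -mul_rows3 mulmxKV.
clearbody c.
(* As in Cramer's rule, dotting with the cross product of two basis vectors isolates one
   coefficient; it is nonzero since the fourth point is not on their join. *)
have c0 : c 0 o0 != 0.
  have := tri _ _ _ P4A P2A P3A; rewrite eq_sym => /(_ n24 n23 n34).
  rewrite x4E !dotDl !dotZl dot_crossl dot_crossr !mulr0 !addr0.
  by apply: contraNneq => ->; rewrite mul0r.
have c1 : c 0 o1 != 0.
  have := tri _ _ _ P4A P1A P3A; rewrite eq_sym => /(_ n14 n13 n34).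
  rewrite x4E !dotDl !dotZl dot_crossl dot_crossr !mulr0 !addr0 add0r.
  by apply: contraNneq => ->; rewrite mul0r.
have c2 : c 0 o2 != 0.
  have := tri _ _ _ P4A P1A P2A; rewrite eq_sym => /(_ n14 n12 n24).
  rewrite x4E !dotDl !dotZl dot_crossl dot_crossr !mulr0 !add0r.
  by apply: contraNneq => ->; rewrite mul0r.
have d' : dot (c 0 o0 *: x1) (cross (c 0 o1 *: x2) (c 0 o2 *: x3)) != 0.
  by rewrite crossZl crossZr dotZl dotC !dotZl !mulf_neq0 // dotC.
have [g gE] := unitmx_GLval (rows3_unit d').
exists g; rewrite !vline_preim_GLimg gE !mul_rows3 !mxE /=.
by rewrite !scale0r !scale1r !addr0 !add0r !vlineZ // -x4E.
Qed.

Lemma subplane_eq_GLimg_stdplane q B : prime_power q -> subplane_of_order q B ->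
  exists g : {'GL_3[K]}, B = GLmap g @: stdplane q K.
Proof.
move=> hq Bq; have [g [e1 e2 e3 u]] := subplane_frame Bq; exists g.
have Bq' := subplane_GLimg g^-1%g Bq.
by rewrite -(subplane_eq_stdplane hq Bq' e1 e2 e3 u) GLimgsetKV.
Qed.

(** The model line X + tY = 0. For t outside F it meets PG(2,F) only in (0,0,1), whence the name. *)
Definition tangent (t : K) : {vspace 'rV[K]_3} := line_of (vec 1 t 0).

Lemma dim_tangent t : \dim (tangent t) = 2%N.
Proof. by rewrite dim_line_of // vec_eq0 oner_eq0. Qed.

Lemma mem_tangent t x : (x \in tangent t) = (x 0 o0 + t * x 0 o1 == 0).
Proof. by rewrite mem_line_of {1}(vecE x) dot_vec mulr1 mulr0 addr0 mulrC (mulrC t). Qed.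

Lemma GLimg_tangent t (M : 'M[K]_3) l : M \in unitmx -> \dim l = 2%N ->
    (forall x, x 0 o0 + t * x 0 o1 = 0 -> x *m M \in l) ->
  exists2 g : {'GL_3[K]}, GLval g = M & GLimg (tangent t) g = l.
Proof.
move=> /unitmx_GLval[g gM] dl Ml; exists g => //.
apply/eqP; rewrite eqEdim dim_GLimg dim_tangent dl leqnn andbT.
apply/subvP=> _ /memv_imgP[x xt ->]; rewrite lfunE /= gM; apply: Ml.
by move: xt; rewrite mem_tangent => /eqP.
Qed.

Lemma line_GLimg_tangent t l : l \in PGlines K ->
  exists g : {'GL_3[K]}, GLimg (tangent t) g = l.
Proof.
rewrite inE => /eqP dl; have [x [y [xl yl c]]] := dim2_cross_neq0 dl.
have [z zc] : exists z, dot z (cross x y) != 0.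
  have [i ci] := rV3_neq0 c; exists (delta_mx 0 i).
  have -> // : dot (delta_mx 0 i) (cross x y) = cross x y 0 i.
  move: (cross x y) => v {ci}; rewrite /dot !mxE.
  by elim/ord3_ind: i; rewrite /= ?mul0r ?mul1r ?addr0 ?add0r.
have d : dot z (cross (x + t *: z) y) != 0.
  rewrite crossDl crossZl dotC dotDl dotZl dotC (dotC _ z).
  by rewrite dot_crossl mulr0 addr0.
(* With [z] off [l] and w0 = - t w1, the multiples of [z] cancel in [w *m rows3 z (x + t *: z) y],
   leaving a combination of [x] and [y]. *)
have [w wt|g _ <-] := GLimg_tangent (rows3_unit d) dl (t := t); last by exists g.
have w0 : w 0 o0 = - (t * w 0 o1) by apply/eqP; rewrite -addr_eq0 wt.
have -> : w *m rows3 z (x + t *: z) y = w 0 o1 *: x + w 0 o2 *: y.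
  by rewrite mul_rows3 w0; apply/rowP=> i; rewrite !mxE; ring.
by rewrite memvD ?memvZ.
Qed.

End Frames.

(** * The stabilizer of PG(2,F) and the lines meeting PG(2,F) in one point *)

Section TangentLines.
Variables (q : nat) (K : finFieldType).
Hypotheses (hq : prime_power q) (hK : #|K| = (q ^ 3)%N).
Notation F := (fixedF K q).
Notation B0 := (stdplane q K).
Implicit Types (t : K) (x y z u : 'rV[K]_3).

Lemma stdplane_tangent t : t \notin F -> #|B0 :&: points_on (tangent t)| = 1%N.
Proof.
move=> tF; have e3 : vec 0 0 1 != 0 :> 'rV[K]_3 by rewrite vec_eq0 oner_eq0 !andbF.
apply/eqP/cards1P; exists <[vec 0 0 1]>%VS; apply/setP=> P; rewrite in_set1 !inE.
apply/and3P/eqP => [[/stdplaneP[x [xr x0 ->]] _]|->]; last first.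
  by rewrite mem_stdplane ?Frational_vec ?(fixedF0 K hq) ?fixedF1 // dim_vline e3 -memvE
    mem_tangent !mxE mulr0 addr0.
rewrite -memvE mem_tangent => /eqP e; apply/vline_eqP => //.
have x1 : x 0 o1 = 0.
  apply: contraNeq tF => x1; have -> : t = - x 0 o0 / x 0 o1.
    by apply: (canRL (mulfK x1)); apply/eqP; rewrite -addr_eq0 addrC e.
  by move/FrationalP: xr => xr; rewrite fixedFM ?fixedFV ?fixedFN.
move: e; rewrite x1 mulr0 addr0 => x00.
by rewrite (vecE x) x00 x1 cross_vec vec_eq0 !(mul0r, mulr0, subrr) eqxx.
Qed.

Lemma stdplane_tangent_trans t l : t \notin F -> l \in PGlines K ->
    #|B0 :&: points_on l| = 1%N ->
  exists g : {'GL_3[K]}, GLmap g @: B0 = B0 /\ GLimg (tangent t) g = l.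
Proof.
move=> tF; rewrite inE => /eqP dl; have [u u0 lu] := dim2_is_line_of dl.
move/eqP/cards1P=> [P BP].
have: P \in B0 :&: points_on l by rewrite BP in_set1.
rewrite !inE => /and3P[/stdplaneP[s [sr s0 PE]] _]; rewrite PE lu vline_le_line_of => /eqP su.
have uniq_s y : Frational q y -> dot y u = 0 -> exists k, y = k *: s.
  move=> yr yu; have [->|y0] := eqVneq y 0; first by exists 0; rewrite scale0r.
  have : <[y]>%VS \in B0 :&: points_on l.
    by rewrite !inE mem_stdplane // dim_vline y0 lu vline_le_line_of yu eqxx.
  by rewrite BP in_set1 PE => /eqP/esym/(vline_eqP s0 y0)/eqP/(cross_eq0 s0).
(* Rational vectors on the line are multiples of [s], so prescribing coordinate [j] to be 0 leaves
   only the zero vector. *)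
have [j sj] := rV3_neq0 s0.
have small y : Frational q y -> dot y u = 0 -> y 0 j = 0 -> y = 0.
  move=> yr yu; have [k ->] := uniq_s y yr yu; rewrite mxE => /eqP.
  by rewrite mulf_eq0 (negPf sj) orbF => /eqP ->; rewrite scale0r.
have [y1 [y2 [y1r y2r y1u y2u]]] : exists y1 y2,
    [/\ Frational q y1, Frational q y2, dot y1 u != 0 & dot y2 u = t * dot y1 u].
  pose v (p : K * K * K) : 'rV[K]_3 := vec p.1.1 p.1.2 p.2.
  have v_inj : injective v.
    move=> [[a b] c] [[a' b'] c'] /rowP e.
    by have := e o0; have := e o1; have := e o2; rewrite !mxE /= => -> -> ->.
  pose X := setX (setX F F) F.
  have vr p : p \in X -> Frational q (v p).
    by case: p => [[a b] c]; rewrite !in_setX => /andP[/andP[aF bF] cF]; apply: Frational_vec.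
  (* Nontriviality of the kernel by pigeonhole: [psi] sends the q^6 pairs of rational vectors into K
     x F x F, of size q^5. The differences of two colliding pairs are [y1] and [y2]. *)
  pose psi p := (t * dot (v p.1) u - dot (v p.2) u, (v p.1 0 j, v p.2 0 j)).
  have [/dinjectiveP inj|/dinjectivePn] := boolP (dinjectiveb psi (setX X X)).
    have : (#|psi @: setX X X| <= #|setX [set: K] (setX F F)|)%N.
      apply/subset_leq_card/subsetP=> _ /imsetP[[p p'] /setXP[pX p'X] ->].
      by rewrite !in_setX in_setT /=; move/FrationalP: (vr _ pX) => ->;
        move/FrationalP: (vr _ p'X) => ->.
    rewrite card_in_imset // !cardsX cardsT hK (card_fixedF hq hK).
    have q1 := prime_power_gt1 hq.
    have -> : (q * q * q * (q * q * q) = q * (q ^ 3 * (q * q)))%N by lia.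
    by rewrite -[leqRHS]mul1n leq_pmul2r ?muln_gt0 ?expn_gt0 ?(ltnW q1) // leqNgt q1.
  case=> -[p1 p2] /setXP[p1X p2X] [[r1 r2]]; rewrite inE => /andP[ne /setXP[r1X r2X]].
  case=> e ej1 ej2; exists (v p1 - v r1), (v p2 - v r2).
  have subE x y : (x - y) 0 j = x 0 j - y 0 j by rewrite !mxE.
  have e' : dot (v p2 - v r2) u = t * dot (v p1 - v r1) u.
    by rewrite !dotBl mulrBr -[t * dot (v p1) u](subrK (dot (v p2) u)) e /=; ring.
  have r1' : Frational q (v p1 - v r1) by rewrite FrationalB ?vr.
  have r2' : Frational q (v p2 - v r2) by rewrite FrationalB ?vr.
  (* If [y1] were on the line, so would be [y2]; both have coordinate [j] zero, so both would vanish
     and the colliding pairs would coincide. *)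
  split=> //; apply: contraNneq ne => d.
  have /subr0_eq/v_inj -> : v p1 - v r1 = 0.
    by apply: small; rewrite // subE ej1 subrr.
  have /subr0_eq/v_inj -> // : v p2 - v r2 = 0.
  by apply: small; rewrite ?e' ?d ?mulr0 // subE ej2 subrr.
have c : cross y1 s != 0.
  apply: contraNneq y1u => /eqP; rewrite crossC oppr_eq0 => /eqP/(cross_eq0 s0)[k ->].
  by rewrite dotZl su mulr0.
have d : dot y1 (cross y2 s) != 0.
  (* A dependence would read y2 = k y1 + m s with k in F; dotting with [u] gives t = k. *)
  apply: contraNneq tF => d.
  have : cross (cross y1 s) (cross y2 s) = 0 by rewrite cross_common d scale0r.
  case/(cross_eq0 c) => k e.
  have kF : k \in F by apply: (FrationalZ_inv c); rewrite -?e ?Frational_cross.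
  have /(cross_eq0 s0)[m ye] : cross s (y2 - k *: y1) = 0.
    by rewrite crossC crossBl crossZl e subrr oppr0.
  have : dot y2 u = k * dot y1 u.
    by rewrite -(subrK (k *: y1) y2) ye dotDl !dotZl su mulr0 add0r.
  by rewrite y2u => /(mulIf y1u) ->.
have [x xt|g gN gl] := GLimg_tangent (rows3_unit d) dl (t := t).
  rewrite lu mem_line_of mul_rows3 !dotDl !dotZl su mulr0 addr0 y2u mulrA -mulrDl.
  by rewrite (mulrC _ t) xt mul0r.
exists g; split; last by rewrite gl.
(* The rows [y1], [y2], [s] of [g] are rational, so [g] maps the finite set [B0] into itself, hence
   onto itself. *)
apply/eqP; rewrite eqEcard card_GLimgset leqnn andbT.
apply/subsetP=> _ /imsetP[_ /stdplaneP[x [xr x0 ->]] ->].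
have : \dim (GLimg <[x]>%VS g) = 1%N by rewrite dim_GLimg dim_vline x0.
rewrite GLimg_vline gN dim_vline mul_rows3 => n0; apply: mem_stdplane.
  by move/FrationalP: xr => xr; rewrite !FrationalD ?FrationalZ.
by case: eqP n0.
Qed.

End TangentLines.

(** * Transitivity of the stabilizer of the line *)

Theorem theorem4p1 (q : nat) (hq : prime_power q) (K : finFieldType)
    (hK : #|K| = (q ^ 3)%N) (linf : {vspace 'rV[K]_3})
    (hlinf : linf \in PGlines K) :
  [transitive 'N_(PGL3 K)(points_on linf | PGLact K)%g,
     on [set B : {set {vspace 'rV[K]_3}} |
           subplane_of_order q B && (#|B :&: points_on linf| == 1%N)]
     | ((PGLact K)^*)%act].
Proof.
(* F has at most q elements, while K has q^3 > q. *)
have [t tF] : exists t, t \notin fixedF K q.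
  apply/existsP; apply: contraTT (prime_power_gt1 hq) => /existsPn F1.
  have : (#|K| <= #|fixedF K q|)%N.
    by rewrite -cardsT; apply/subset_leq_card/subsetP=> a _; have := F1 a; rewrite negbK.
  move/leq_trans/(_ (card_fixedF_le K hq)); rewrite hK -leqNgt -{2}(expn1 q).
  by case: (ltnP 1 q) => // q1; rewrite leq_exp2l.
have actE (g : {'GL_3[K]}) B : ((PGLact K)^*)%act B (coset 'Z('GL_3[K]) g) = GLmap g @: B.
  by apply: eq_imset => U; apply: PGLactE.
have [h hl] := line_GLimg_tangent t hlinf.
set T := [set B | _].
have TP g : GLimg (tangent t) g = linf -> GLmap g @: stdplane q K \in T.
  move=> gl; rewrite inE subplane_GLimg ?subplane_stdplane //=.
  by rewrite -gl -GLimgset_points_on -GLimgsetI card_GLimgset stdplane_tangent.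
(* The base point of the orbit is the image of PG(2,F) under [h], which carries the model line to
   [linf]. *)
apply/imsetP; exists (GLmap h @: stdplane q K); first exact: TP.
apply/setP=> B; apply/idP/orbitP => [|[a]].
  rewrite inE => /andP[Bq /eqP B1].
  have [g BE] := subplane_eq_GLimg_stdplane hq Bq.
  have l'L : GLimg linf g^-1%g \in PGlines K.
    by move: hlinf; rewrite !inE dim_GLimg.
  have l'1 : #|stdplane q K :&: points_on (GLimg linf g^-1%g)| = 1%N.
    by rewrite -(card_GLimgset g) GLimgsetI -BE GLimgset_points_on GLimgKV.
  have [k [kB kl]] := stdplane_tangent_trans hq hK tF l'L l'1.
  (* Read from left to right: [linf] goes to the model line, then to its preimage under [g], then
     back to [linf], while the base subplane goes to PG(2,F), is kept by [k], and ends at [B]. *)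
  pose f := (h^-1 * (k * g))%g.
  have fl : GLimg linf f = linf.
    by rewrite /f !(actM (GLact K)) /= -hl GLimgK kl GLimgKV.
  exists (coset 'Z('GL_3[K]) f); last first.
    rewrite actE -GLimgsetM /f mulgA mulgV mul1g GLimgsetM kB -BE //.
  have fG : coset 'Z('GL_3[K]) f \in PGL3 K by apply: mem_quotient; rewrite inE.
  apply/setIP; split=> //; apply/setIP; split; first exact: fG.
  rewrite inE; apply/subsetP=> P Pl; rewrite in_set.
  have -> : PGLact K P (coset 'Z('GL_3[K]) f) = GLimg P f by apply: PGLactE.
  by rewrite -fl -GLimgset_points_on mem_GLimgset.
(* Conversely, an element stabilizing the points of [linf] preserves subplanes and the number of
   their points on [linf]. *)
case/setIP=> aG /astabs_setact aS <-.
have /morphimP[g _ _ aE] := aG.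
move: aS; rewrite aE !actE => gS.
rewrite inE !subplane_GLimg ?subplane_stdplane //=.
by rewrite -gS -GLimgsetI card_GLimgset -hl -GLimgset_points_on -GLimgsetI card_GLimgset
  stdplane_tangent.
Qed.
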